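(* Let $G$ be a finite clique of finitely-generated groups, i.e. a finite graph $(V, E, (\Gamma_u)_{u\in V})$ in which every two distinct nodes are adjacent and each node $u$ is assigned a finitely-generated group $\Gamma_u$, and suppose that exactly one of the vertex groups, denoted $\Delta$, is non-amenable. Then $\Gamma(G)$ splits non-trivially over an amenable subgroup if and only if $\Delta$ does.
   Context: $\Gamma(G)$ denotes the graph product: $\Gamma(G) = \langle \bigcup_{u \in V} \Gamma_u \mid [\Gamma_u, \Gamma_v] \text{ for } (u,v) \in E\rangle$, where the vertex groups are taken disjoint apart from sharing the identity; for a clique this is the direct product of the vertex groups. A finitely generated group splits (non-trivially) over an amenable subgroup if it admits an action on a tree with no globally fixed vertices, no edge inversions, and all edge stabilizers amenable. *)

(* Defs.v *)
From HB Require Import structures.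
From mathcomp Require Import all_boot all_order all_algebra.
From mathcomp Require Import generic_quotient boolp reals.
From Stdlib Require Import Relation_Operators.

Set Implicit Arguments.
Unset Strict Implicit.
Unset Printing Implicit Defensive.

Import Order.TTheory GRing.Theory Num.Theory.
Local Open Scope quotient_scope.
Local Open Scope group_scope.

(* [groupType] (boot/monoid.v) does not assume finiteness. *)
Definition finitely_generated (G : groupType) : Prop :=
  exists s : seq G, forall H : {pred G},
    group_closed H -> {subset s <= H} -> forall g, g \in H.

Definition is_bounded (R : realType) (T : Type) (f : T -> R) : Prop :=
  exists M : R, forall x, (`|f x| <= M)%R.

(* A left-invariant mean on the bounded functions on G; the values of m outside
   the bounded functions are irrelevant. *)
Record invariant_mean (R : realType) (G : groupType) (m : (G -> R) -> R) :
    Prop := InvariantMean {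
  mean_linear : forall (c : R) (f h : G -> R), is_bounded f -> is_bounded h ->
    m (fun x => c * f x + h x)%R = (c * m f + m h)%R;
  mean_ge0 : forall f : G -> R, is_bounded f ->
    (forall x, 0 <= f x)%R -> (0 <= m f)%R;
  mean_one : m (fun=> 1%R) = 1%R;
  mean_left_invariant : forall (g : G) (f : G -> R), is_bounded f ->
    m (fun x => f (g * x)) = m f
}.

Definition amenable (R : realType) (G : groupType) : Prop :=
  exists m : (G -> R) -> R, invariant_mean m.

(* A tree is given by the adjacency relation of a simple graph, possibly
   infinite and not locally finite, but nonempty. *)
Record is_tree (T : eqType) (adj : rel T) : Prop := IsTree {
  tree_inhabited : inhabited T;
  tree_sym : symmetric adj;
  tree_irrefl : irreflexive adj;
  tree_connected : forall x y, exists2 p, path adj x p & last x p = y;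
  tree_acyclic : forall c, ucycle adj c -> (size c <= 2)%N
}.

Record left_action (G : groupType) (X : Type) := LeftAction {
  lact :> G -> X -> X;
  lact1 : forall x, lact 1 x = x;
  lactM : forall g h x, lact (g * h) x = lact g (lact h x)
}.

(* The setwise stabilizer of the unordered pair {x, y}. *)
Definition edge_stab (G : groupType) (T : eqType) (a : left_action G T)
    (x y : T) : pred G := fun g =>
  (a g x == x) && (a g y == y) || (a g x == y) && (a g y == x).

Definition edge_stabilizer (G : groupType) (T : eqType) (a : left_action G T)
    (x y : T) := {g : G | edge_stab a x y g}.

Section EdgeStabilizer.
Variables (G : groupType) (T : eqType) (a : left_action G T) (x y : T).

Fact lactVK g z : a g^-1 (a g z) = z.
Proof. by rewrite -lactM mulVg lact1. Qed.

Fact edge_stab_closed : group_closed (edge_stab a x y).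
Proof.
split=> [|g h]; first by rewrite /in_mem /= /edge_stab !lact1 !eqxx.
rewrite /in_mem /= /edge_stab !lactM => gS.
have: forall z t, a h z = t -> a h^-1 t = z by move=> z t <-; rewrite lactVK.
by move=> hV /orP[] /andP[/eqP/hV-> /eqP/hV->]; move: gS;
  case/orP=> /andP[/eqP-> /eqP->]; rewrite !eqxx ?orbT.
Qed.

HB.instance Definition _ :=
  [isSub of edge_stabilizer a x y for @sval _ _].
HB.instance Definition _ := [Choice of edge_stabilizer a x y by <:].
HB.instance Definition _ :=
  SubChoice_isSubGroup.Build G (edge_stab a x y) (edge_stabilizer a x y)
    edge_stab_closed.

End EdgeStabilizer.

Definition splits_over_amenable (R : realType) (G : groupType) : Prop :=
  exists (T : eqType) (adj : rel T) (a : left_action G T),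
    [/\ is_tree adj /\ (forall g x y, adj (a g x) (a g y) = adj x y),
        ~ (exists x, forall g, a g x = x),
        ~ (exists g x y, [/\ adj x y, a g x = y & a g y = x])
      & forall x y, adj x y -> amenable R (edge_stabilizer a x y)].

(* The graph product, as words in the letters (u, g) with g in Gam u modulo the
   congruence generated by its presentation. Identity letters of all vertex
   groups are identified with the empty word, and since g and g^-1 are both
   letters no formal inverses are needed. *)
Section GraphProduct.
Variables (V : finType) (E : rel V) (Gam : V -> groupType).

Definition letter := {u : V & Gam u}.
HB.instance Definition _ := Choice.on letter.

Definition syl (u : V) (g : Gam u) : letter := Tagged Gam g.

Inductive gp_step : seq letter -> seq letter -> Prop :=
| gp_step1 p q u : gp_step (p ++ [:: syl (1 : Gam u)] ++ q) (p ++ q)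
| gp_stepM p q u (g h : Gam u) :
    gp_step (p ++ [:: syl g; syl h] ++ q) (p ++ [:: syl (g * h)] ++ q)
| gp_stepC p q u v (g : Gam u) (h : Gam v) : E u v ->
    gp_step (p ++ [:: syl g; syl h] ++ q) (p ++ [:: syl h; syl g] ++ q).

Definition gp_eqv : seq letter -> seq letter -> Prop :=
  clos_refl_sym_trans _ gp_step.

Definition gp_rel : rel (seq letter) := fun w1 w2 => `[< gp_eqv w1 w2 >].

Fact gp_rel_equiv : equiv_class_of gp_rel.
Proof.
split=> [w|w1 w2|w1 w2 w3].
- exact/asboolP/rst_refl.
- by apply/asboolP/asboolP; apply: rst_sym.
- by move=> /asboolP h12 /asboolP h23; apply/asboolP/(rst_trans _ _ _ _ _ h12).
Qed.

Canonical gp_equiv_rel := EquivRelPack gp_rel_equiv.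

Definition graph_product := {eq_quot gp_rel}.
HB.instance Definition _ := Choice.on graph_product.
HB.instance Definition _ := EqQuotient.on graph_product.

Definition gp_class (w : seq letter) : graph_product := \pi_graph_product w.

Definition word_inv (w : seq letter) : seq letter :=
  rev [seq let: existT u g := x in syl (g^-1 : Gam u) | x <- w].

Definition gp_one : graph_product := gp_class [::].
Definition gp_mul (a b : graph_product) : graph_product :=
  gp_class (repr a ++ repr b).
Definition gp_inv (a : graph_product) : graph_product :=
  gp_class (word_inv (repr a)).

Fact gp_classP w1 w2 : gp_class w1 = gp_class w2 <-> gp_eqv w1 w2.
Proof.
split=> [/eqmodP/asboolP //|h]; exact/eqmodP/asboolP.
Qed.

Fact gp_class_repr a : gp_class (repr a) = a.
Proof. exact: reprK. Qed.

Fact gp_eqv_catl p w1 w2 : gp_eqv w1 w2 -> gp_eqv (p ++ w1) (p ++ w2).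
Proof.
elim=> {w1 w2} [w1 w2 []|w|w1 w2 _|w1 w2 w3 _ h12 _].
- by move=> p' q u; rewrite !(catA p); apply/rst_step/gp_step1.
- by move=> p' q u g h; rewrite !(catA p); apply/rst_step/gp_stepM.
- by move=> p' q u v g h uv; rewrite !(catA p); apply/rst_step/gp_stepC.
- exact: rst_refl.
- exact: rst_sym.
- exact: rst_trans.
Qed.

Fact gp_eqv_catr q w1 w2 : gp_eqv w1 w2 -> gp_eqv (w1 ++ q) (w2 ++ q).
Proof.
elim=> {w1 w2} [w1 w2 []|w|w1 w2 _|w1 w2 w3 _ h12 _].
- by move=> p q' u; rewrite -!catA; apply/rst_step/gp_step1.
- by move=> p q' u g h; rewrite -!catA; apply/rst_step/gp_stepM.
- by move=> p q' u v g h uv; rewrite -!catA; apply/rst_step/gp_stepC.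
- exact: rst_refl.
- exact: rst_sym.
- exact: rst_trans.
Qed.

Fact gp_mulE w1 w2 : gp_mul (gp_class w1) (gp_class w2) = gp_class (w1 ++ w2).
Proof.
apply/gp_classP; apply: (@rst_trans _ _ _ (w1 ++ repr (gp_class w2))).
  by apply/gp_eqv_catr/gp_classP; rewrite gp_class_repr.
by apply/gp_eqv_catl/gp_classP; rewrite gp_class_repr.
Qed.

Fact word_invVw w : gp_eqv (word_inv w ++ w) [::].
Proof.
elim: w => [|[u g] w IHw]; first exact: rst_refl.
rewrite /word_inv /= rev_cons -/(word_inv w) cat_rcons.
apply: rst_trans IHw; apply: rst_trans.
  exact/rst_step/(gp_stepM (word_inv w) w g^-1 g).
by rewrite mulVg; apply/rst_step/gp_step1.
Qed.

Fact word_invwV w : gp_eqv (w ++ word_inv w) [::].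
Proof.
elim: w => [|[u g] w IHw]; first exact: rst_refl.
rewrite /word_inv /= rev_cons -/(word_inv w) -cats1 catA.
apply: rst_trans (gp_eqv_catl [:: syl g] (gp_eqv_catr [:: syl g^-1] IHw)) _.
apply: rst_trans (rst_step _ _ _ _ (gp_stepM [::] [::] g g^-1)) _.
by rewrite mulgV; apply/rst_step/(gp_step1 [::] [::]).
Qed.

Fact gp_mulA : associative gp_mul.
Proof.
move=> a b c; rewrite -(gp_class_repr a) -(gp_class_repr b) -(gp_class_repr c).
by rewrite !gp_mulE catA.
Qed.

Fact gp_mul1g : left_id gp_one gp_mul.
Proof. by move=> a; rewrite -(gp_class_repr a) gp_mulE. Qed.

Fact gp_mulg1 : right_id gp_one gp_mul.
Proof. by move=> a; rewrite -(gp_class_repr a) gp_mulE cats0. Qed.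

Fact gp_mulVg : left_inverse gp_one gp_inv gp_mul.
Proof.
by move=> a; rewrite -{2}(gp_class_repr a) gp_mulE; apply/gp_classP/word_invVw.
Qed.

Fact gp_mulgV : right_inverse gp_one gp_inv gp_mul.
Proof.
by move=> a; rewrite -{1}(gp_class_repr a) gp_mulE; apply/gp_classP/word_invwV.
Qed.

HB.instance Definition _ := isGroup.Build graph_product
  gp_mulA gp_mul1g gp_mulg1 gp_mulVg gp_mulgV.

End GraphProduct.

(* Main.v *)
Require Import Defs.
From mathcomp Require Import all_boot all_order all_algebra.
From mathcomp Require Import generic_quotient boolp reals.
From Stdlib Require Import Relation_Operators.

Set Implicit Arguments.
Unset Strict Implicit.
Unset Printing Implicit Defensive.

Import Order.TTheory GRing.Theory Num.Theory.
Local Open Scope group_scope.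

(** Over a clique the graph product [Pi] is the direct product of the
    non-amenable factor [D = Gam d] and of amenable groups; [D] is both a
    normal subgroup and a quotient of [Pi], through [vertex_incl] and
    [vertex_proj].

    If [D] splits, [Pi] acts on the same tree through the projection
    ([splits_pullback]). Only the edge stabilizers change: each becomes the
    product of an edge stabilizer of [D] with the amenable factors, and such a
    product is amenable ([vertex_proj_preimage_has_mean]).

    If [Pi] splits, restrict its action to [D] ([splits_restrict]). Edge
    stabilizers shrink to subgroups, which remain amenable
    ([amenable_of_injective]), so the only issue is a vertex [x] fixed by [D].
    As [D] is normal, it also fixes all the translates of [x]. Some translate
    differs from [x], since [Pi] has no fixed vertex, and a tree automorphism
    that fixes two vertices fixes the path between them
    ([tree_fixed_edge]). Hence [D] fixes an edge and is a subgroup of an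
    amenable edge stabilizer, contradicting its non-amenability.

    Amenability is handled through means on the functions on an ambient group
    that are invariant only under a given set of its elements ([has_mean]):
    such means can be combined along commuting images of amenable groups
    without forming any product or quotient group, and they are carried back
    to a subgroup by means of a transversal of its cosets. *)

(** * Means invariant under a set of elements *)

Section Means.
Variables (R : realType) (G : groupType).
Implicit Types (P Q : G -> Prop) (m : (G -> R) -> R) (f : G -> R).

Record mean_invariant_under P m : Prop := MeanInvariantUnder {
  minv_linear : forall (c : R) (f h : G -> R), is_bounded f -> is_bounded h ->
    m (fun x => c * f x + h x)%R = (c * m f + m h)%R;
  minv_ge0 : forall f, is_bounded f ->
    (forall x, 0 <= f x)%R -> (0 <= m f)%R;
  minv_one : m (fun=> 1%R) = 1%R;
  minv_invariant : forall g, P g -> forall f, is_bounded f ->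
    m (fun x => f (g * x)) = m f
}.

Definition has_mean P := exists m, mean_invariant_under P m.

Lemma amenable_has_mean : amenable R G -> has_mean (fun=> True).
Proof. by case=> m [lin ge0 one inv]; exists m; split=> // g _; exact: inv. Qed.

Lemma bounded_comp (S T : Type) (k : S -> T) (f : T -> R) :
  is_bounded f -> is_bounded (f \o k).
Proof. by case=> M fM; exists M => x; exact: fM. Qed.

Lemma bounded_cst (T : Type) (c : R) : is_bounded (fun _ : T => c).
Proof. by exists `|c|%R. Qed.

Lemma bounded_lin (T : Type) (c : R) (f h : T -> R) :
  is_bounded f -> is_bounded h -> is_bounded (fun x => c * f x + h x)%R.
Proof.
case=> M fM [N hN]; exists (`|c| * M + N)%R => x.
by rewrite (le_trans (ler_normD _ _))// lerD// normrM ler_wpM2l.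
Qed.

(** Positivity bounds a mean by the supremum norm; this makes means of
    functions depending boundedly on a parameter bounded in that parameter, so
    that means can be iterated. *)
Lemma minv_norm P m f (M : R) : mean_invariant_under P m ->
  (forall x, `|f x| <= M)%R -> (`|m f| <= M)%R.
Proof.
move=> [lin ge0 one _] fM; have bf : is_bounded f by exists M.
have b1 := bounded_cst G 1%R.
have b0 := bounded_cst G 0%R.
have m0 : m (fun=> 0%R) = 0%R.
  by have := lin (-1)%R _ _ b1 b1; rewrite one mulr1 addNr.
have mM : m (fun=> M) = M.
  by have := lin M _ _ b1 b0; rewrite one m0 mulr1 addr0.
have bM := bounded_cst G M.
have {}fM x : (- M <= f x <= M)%R by rewrite -ler_norml.
rewrite ler_norml; apply/andP; split.
  have := ge0 _ (bounded_lin 1 bf bM); rewrite lin// mM mul1r -lerBlDr sub0r.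
  by apply=> x; rewrite mul1r -lerBlDr sub0r; case/andP: (fM x).
have := ge0 _ (bounded_lin (-1) bf bM); rewrite lin// mM mulN1r addrC subr_ge0.
by apply=> x; rewrite mulN1r addrC subr_ge0; case/andP: (fM x).
Qed.

(** The elements that leave a mean invariant are closed under products. *)
Lemma has_mean_products P Q : has_mean P ->
  (forall g, Q g ->
     exists2 s : seq G, {in s, forall x, P x} & g = foldr *%g 1 s) ->
  has_mean Q.
Proof.
move=> [m [lin ge0 one inv]] PQ; exists m; split=> // g /PQ[s sP ->] {g PQ}.
elim: s sP => [_ f _|g s IHs sP f bf] /=.
  by congr m; apply/funext => x; rewrite mul1g.
have bgf : is_bounded (fun x => f (g * x)) by exact: bounded_comp.
rewrite -(inv g (sP g (mem_head _ _)) f bf) -[RHS]IHs//.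
  by congr m; apply/funext => x; rewrite mulgA.
by move=> x xs; apply: sP; rewrite inE xs orbT.
Qed.

Lemma has_mean_sub P Q : has_mean P -> (forall g, Q g -> P g) -> has_mean Q.
Proof. by move=> [m [lin ge0 one inv]] QP; exists m; split=> // g /QP/inv. Qed.

(** Evaluation at [1] is the mean from which all others are built. *)
Lemma has_mean_dirac : has_mean (fun=> False).
Proof. by exists (fun f => f 1); split. Qed.

End Means.

Lemma morphM1 (G H : groupType) (phi : G -> H) :
  {morph phi : x y / x * y} -> phi 1 = 1.
Proof. by move=> phiM; apply: (mulgI (phi 1)); rewrite -phiM !mulg1. Qed.

Section Transfer.
Variables (R : realType) (G : groupType).
Implicit Types (P : G -> Prop).

(** With [n] an invariant mean on [H] and [m] the given one, average [f] by
    [m] over each translate [phi x * _], then average over [x] by [n].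
    Translation by [phi h] is absorbed by [n]; translation by an element of [P]
    moves past [phi x] and is absorbed by [m]. *)
Lemma has_mean_commuting (H : groupType) (phi : H -> G) P :
  amenable R H -> {morph phi : x y / x * y} -> has_mean R P ->
  (forall h g, P g -> commute g (phi h)) ->
  has_mean R (fun g => P g \/ exists h, g = phi h).
Proof.
move=> /amenable_has_mean[n nP] phiM [m mP] comm.
have bmf f : is_bounded f -> is_bounded (fun x => m (fun y => f (phi x * y))).
  by case=> M fM; exists M => x; exact: (minv_norm mP).
have bt f x : is_bounded f -> is_bounded (fun y => f (phi x * y) : R).
  exact: bounded_comp.
exists (fun f => n (fun x => m (fun y => f (phi x * y)))); split.
- move=> c f h bf bh; rewrite -(minv_linear nP); [|exact: bmf..].
  by congr n; apply/funext => x; rewrite -(minv_linear mP); [|exact: bt..].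
- move=> f bf f0; apply: (minv_ge0 nP) => [|x]; first exact: bmf.
  by apply: (minv_ge0 mP) => // ; exact: bt.
- by rewrite (minv_one mP) (minv_one nP).
- move=> g [Pg|[h ->]] f bf.
    congr n; apply/funext => x; rewrite -[RHS](minv_invariant mP Pg); last exact: bt.
    by congr m; apply/funext => y; rewrite !mulgA (comm _ _ Pg).
  rewrite -[RHS](@minv_invariant _ _ _ _ nP h I); last exact: bmf.
  by congr n; apply/funext => x; congr m; apply/funext => y; rewrite phiM mulgA.
Qed.

Lemma has_mean_commuting_family (I : eqType) (H : I -> groupType)
    (phi : forall i, H i -> G) (s : seq I) P :
  uniq s -> {in s, forall i, amenable R (H i)} ->
  (forall i, {morph phi i : x y / x * y}) -> has_mean R P ->
  {in s, forall i h g, P g -> commute g (phi i h)} ->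
  (forall i j h k, i != j -> commute (phi i h) (phi j k)) ->
  has_mean R (fun g => P g \/ exists2 i, i \in s & exists h, g = phi i h).
Proof.
move=> + + phiM mP; elim: s => [|i s IHs] /=.
  by move=> _ _ _ _; apply: has_mean_sub mP _ => g [|[]].
case/andP=> si us amen commP comm.
have sS j : j \in s -> j \in i :: s by rewrite inE orbC => ->.
have {}IHs := IHs us (fun j js => amen j (sS j js))
  (fun j js => commP j (sS j js)) comm.
have := @has_mean_commuting _ (phi i) _ (amen i (mem_head _ _)) (phiM i) IHs.
have cg h g : P g \/ (exists2 j, j \in s & exists k, g = phi j k) ->
    commute g (phi i h).
  case=> [Pg|[j js [k ->]]]; first by apply: commP; rewrite ?mem_head.
  by apply: comm; apply: contraNneq si => <-.
move=> /(_ cg)/has_mean_sub; apply=> g [Pg|[j]]; first by left; left.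
rewrite inE => /predU1P[->|js] gE; first by right.
by left; right; exists j.
Qed.

(** Choosing a representative [r g] in each coset [phi(H) g] yields an
    [H]-equivariant map [c : G -> H], [g = phi (c g) * r g], along which
    functions on [H] are pulled back to [G] and averaged there. *)
Lemma amenable_of_injective (H : groupType) (phi : H -> G) P :
  {morph phi : x y / x * y} -> injective phi -> (forall h, P (phi h)) ->
  has_mean R P -> amenable R H.
Proof.
move=> phiM phiI phiP [m [lin ge0 one inv]].
pose coset g : pred G := fun x => `[< exists h, g = phi h * x >].
have phi1 := morphM1 phiM.
have cosetxx g : coset g g by apply/asboolP; exists 1; rewrite phi1 mul1g.
have cosetM h g : coset (phi h * g) =1 coset g.
  move=> x; apply/asboolP/asboolP => [[k]|[k ->]]; last first.
    by exists (h * k); rewrite phiM mulgA.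
  move/(congr1 ( *%g (phi h^-1))); rewrite !mulgA -!phiM mulVg phi1 mul1g.
  by exists (h^-1 * k).
(* [choose] depends only on the coset as a set, hence [r] is constant on it. *)
pose r g := choose (coset g) g.
have rM h g : r (phi h * g) = r g.
  rewrite /r (eq_choose (cosetM h g)); apply: choose_id => //.
  by rewrite -(cosetM h).
have [c cP] : {c : G -> H & forall g, g = phi (c g) * r g}.
  apply: (@choice _ _ (fun g h => g = phi h * r g)) => g.
  exact/asboolP/(@chooseP _ (coset g) g).
have cM h g : c (phi h * g) = h * c g.
  by apply/phiI/(mulIg (r g)); rewrite phiM -mulgA -cP -[in r g](rM h) -cP.
exists (fun f => m (f \o c)); split=> //.
- by move=> a f h bf bh; apply: (lin a (f \o c) (h \o c)); exact: bounded_comp.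
- by move=> f bf f0; apply: ge0 => [|x]; [exact: bounded_comp|exact: f0].
- move=> h f bf; rewrite -[RHS](inv (phi h)) //; last exact: bounded_comp.
  by congr m; apply/funext => x /=; rewrite cM.
Qed.

End Transfer.

(** * Fixed points in trees *)

Section Trees.
Variables (T : eqType) (adj : rel T).
Hypothesis treeT : is_tree adj.

(** Removing a vertex disconnects its neighbours: a path between two of them
    avoiding [x] would close up into a cycle through [x]. *)
Lemma tree_no_bypass x z t p : adj x z -> adj x t -> z != t ->
  path adj z p -> last z p = t -> x \in z :: p.
Proof.
move=> xz xt zt zp pt; apply/negPn/negP => xp.
case/shortenP: zp pt => q zq uq qp qt.
have xq : x \notin z :: q.
  apply: contra xp; rewrite !inE => /orP[->//|/qp->]; exact: orbT.
have /(tree_acyclic treeT) : ucycle adj [:: x, z & q].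
  rewrite /ucycle cons_uniq xq uq andbT /= xz rcons_path zq qt.
  by rewrite (tree_sym treeT) xt.
by case: q {zq uq qp xq} qt => [|//] /= qt; rewrite qt eqxx in zt.
Qed.

(** Otherwise, following the first path to [y] and then the second one
    backwards joins two neighbours of [x] without visiting [x]. *)
Lemma tree_first_step x y z t p q :
  path adj x (z :: p) -> uniq [:: x, z & p] -> last z p = y ->
  path adj x (t :: q) -> uniq [:: x, t & q] -> last t q = y -> z = t.
Proof.
move=> /= /andP[xz zp] /andP[xp _] py /andP[xt tq] /andP[xq _] qy.
apply/eqP/negPn/negP => zt.
have rq : path adj y (rev (belast t q)).
  rewrite -qy rev_path; rewrite (eq_path (e' := adj)) // => u v /=.
  by rewrite (tree_sym treeT).
have lq : last y (rev (belast t q)) = t.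
  by rewrite -qy; case: (q) => //= u q'; rewrite rev_cons last_rcons.
have := @tree_no_bypass x z t (p ++ rev (belast t q)) xz xt zt.
rewrite cat_path last_cat zp py rq lq => /(_ isT erefl).
apply/negP; rewrite -cat_cons mem_cat mem_rev negb_or xp /=.
by apply: contra xq; exact: mem_belast.
Qed.

(** Every group element maps the simple path from [x] to [y] to a simple path
    with the same ends, hence fixes its second vertex. *)
Lemma tree_fixed_edge (G : groupType) (a : left_action G T) x y :
  (forall g u v, adj (a g u) (a g v) = adj u v) ->
  (forall g, a g x = x) -> (forall g, a g y = y) -> x != y ->
  exists2 z, adj x z & forall g, a g z = z.
Proof.
move=> aadj ax ay xy.
have [p xp] := tree_connected treeT x y.
case/shortenP: xp => [[|z q]] xq uq _ qy; first by rewrite -qy eqxx in xy.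
exists z => [|g]; first by case/andP: xq.
have agI : injective (a g) by move=> u v /(congr1 (a g^-1)); rewrite !lactVK.
apply: (@tree_first_step x y _ _ (map (a g) q) q) => //.
- rewrite -[X in path _ X](ax g) -map_cons path_map.
  by rewrite (eq_path (e' := adj)) // => u v /=; rewrite aadj.
- by rewrite -[X in X :: _](ax g) -!map_cons map_inj_uniq.
- by rewrite last_map [last z q]qy ay.
Qed.

End Trees.

(** * Graph products over a clique *)

Section CliqueProduct.
Variables (V : finType) (E : rel V) (Gam : V -> groupType).
Hypothesis (E_irrefl : irreflexive E).
Hypothesis (E_clique : forall u v : V, u != v -> E u v).
Local Notation Pi := (graph_product E Gam).

Lemma gp_classM (w1 w2 : seq (letter Gam)) :
  gp_class E w1 * gp_class E w2 = gp_class E (w1 ++ w2).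
Proof. exact: gp_mulE. Qed.

Definition vertex_incl u (g : Gam u) : Pi := gp_class E [:: syl g].

Lemma vertex_inclM u : {morph @vertex_incl u : g h / g * h}.
Proof.
move=> g h; rewrite /vertex_incl gp_classM; apply/gp_classP/rst_sym/rst_step.
exact: (gp_stepM E [::] [::]).
Qed.

Lemma vertex_incl_commute u v (g : Gam u) (h : Gam v) :
  u != v -> commute (vertex_incl g) (vertex_incl h).
Proof.
move=> uv; rewrite /commute /vertex_incl !gp_classM.
by apply/gp_classP/rst_step/(gp_stepC [::] [::])/E_clique.
Qed.

Variable d : V.

Definition letter_proj (x : letter Gam) : Gam d :=
  @untag V (fun u => Gam u) (Gam d) 1 d id x.

Definition word_proj (w : seq (letter Gam)) : Gam d :=
  foldr (fun x g => letter_proj x * g) 1 w.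

Definition vertex_proj (g : Pi) : Gam d := word_proj (repr g).

Lemma letter_proj_id (g : Gam d) : letter_proj (syl g) = g.
Proof. by rewrite /letter_proj (untagE _ _ (erefl : tag (syl g) = d)). Qed.

Lemma letter_proj_neq (x : letter Gam) : tag x != d -> letter_proj x = 1.
Proof. exact: untag_dflt. Qed.

Lemma letter_projM u (g h : Gam u) :
  letter_proj (syl (g * h)) = letter_proj (syl g) * letter_proj (syl h).
Proof.
have [ud|ud] := eqVneq u d; last by rewrite !letter_proj_neq ?mulg1.
by subst u; rewrite !letter_proj_id.
Qed.

Lemma word_proj_cat w1 w2 : word_proj (w1 ++ w2) = word_proj w1 * word_proj w2.
Proof.
by elim: w1 => [|x w IHw] /=; [rewrite mul1g | rewrite IHw mulgA].
Qed.

(** Irreflexivity of [E] matters for the commutation relations: at most one of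
    two adjacent letters lies over [d], so their projections commute whether or
    not [Gam d] is abelian. *)
Lemma word_proj_eqv w1 w2 : gp_eqv E w1 w2 -> word_proj w1 = word_proj w2.
Proof.
elim=> {w1 w2} [w1 w2 []|//|//|w1 w2 w3 _ -> _ ->//].
- move=> p q u; rewrite !word_proj_cat /= mulg1.
  suff -> : letter_proj (syl (1 : Gam u)) = 1 by rewrite mul1g.
  apply: (mulgI (letter_proj (syl (1 : Gam u)))).
  by rewrite -letter_projM !mulg1.
- by move=> p q u g h; rewrite !word_proj_cat /= letter_projM !mulg1.
- move=> p q u v g h uv; rewrite !word_proj_cat /= !mulg1.
  have [ud|ud] := eqVneq u d; last first.
    by rewrite [letter_proj (syl g)]letter_proj_neq // mul1g mulg1.
  rewrite [letter_proj (syl h)]letter_proj_neq ?mul1g ?mulg1 //.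
  by apply: contraTneq uv => /= vd; rewrite ud vd E_irrefl.
Qed.

Lemma vertex_projE w : vertex_proj (gp_class E w) = word_proj w.
Proof. by apply/word_proj_eqv/gp_classP; rewrite gp_class_repr. Qed.

Lemma vertex_projM : {morph vertex_proj : g h / g * h}.
Proof.
move=> g h; rewrite -(gp_class_repr g) -(gp_class_repr h) gp_classM.
by rewrite !vertex_projE word_proj_cat.
Qed.

Lemma vertex_inclK : cancel (@vertex_incl d) vertex_proj.
Proof. by move=> g; rewrite vertex_projE /= letter_proj_id mulg1. Qed.

(** The letters over [d] can be moved to the front, where their product is the
    projection to [Gam d]. *)
Lemma clique_decomp (g : Pi) : exists2 s : seq {u : V & Gam u},
  {in s, forall x, tag x != d}
  & g = vertex_incl (vertex_proj g) *
        foldr *%g 1 [seq vertex_incl (tagged x) | x <- s].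
Proof.
rewrite -(gp_class_repr g) vertex_projE; elim: (repr g) => {g} [|[u g] w [s sd wE]].
  exists [::] => //=; rewrite mulg1; apply/gp_classP/rst_sym/rst_step.
  exact: (gp_step1 E [::] [::]).
rewrite -cat1s -gp_classM wE /= -/(vertex_incl g).
have [ud|ud] := eqVneq u d.
  by exists s => //; subst u; rewrite letter_proj_id vertex_inclM mulgA.
exists (existT _ u g :: s) => [x|]; first by rewrite inE => /predU1P[->|/sd].
rewrite [letter_proj _]letter_proj_neq // mul1g /= !mulgA.
by congr (_ * _); exact: vertex_incl_commute.
Qed.

(** The preimage of [phi(H)] is generated by commuting images of [H] and of the
    amenable vertex groups. It is the product of [phi(H)] with those groups, so
    this is its amenability, expressed inside the graph product. *)
Lemma vertex_proj_preimage_has_mean (R : realType) (H : groupType)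
    (phi : H -> Gam d) :
  {morph phi : x y / x * y} -> amenable R H ->
  (forall u, u != d -> amenable R (Gam u)) ->
  has_mean R (fun g : Pi => exists h, vertex_proj g = phi h).
Proof.
move=> phiM amenH amen.
have inclM : {morph (fun h => vertex_incl (phi h)) : x y / x * y}.
  by move=> x y; rewrite phiM vertex_inclM.
have comm0 h (g : Pi) : False -> commute g (vertex_incl (phi h)) by [].
have mH := has_mean_commuting amenH inclM (has_mean_dirac R Pi) comm0.
have sd u : u \in enum (predC1 d) -> u != d by rewrite mem_enum.
have mG := has_mean_commuting_family (enum_uniq (predC1 d))
  (fun u us => amen u (sd u us)) vertex_inclM mH.
apply: has_mean_products (mG _ _) _ => [u us k g [//|[h ->]]|u v h k uv|].
- by apply: vertex_incl_commute; rewrite eq_sym sd.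
- exact: vertex_incl_commute.
- move=> g [h gh]; have [s s_d gE] := clique_decomp g.
  exists (vertex_incl (phi h) :: [seq vertex_incl (tagged x) | x <- s]); last first.
    by rewrite [LHS]gE gh.
  move=> x; rewrite inE => /predU1P[->|/mapP[[u k] /= us ->]].
    by left; right; exists h.
  by right; exists u; [rewrite mem_enum; exact: (s_d _ us) | exists k].
Qed.

(** By [clique_decomp], [g] acts on [Gam d] by conjugation as its projection
    does. *)
Lemma vertex_incl_normal (g : Pi) (h : Gam d) :
  exists k : Gam d, vertex_incl h * g = g * vertex_incl k.
Proof.
have [s sd gE] := clique_decomp g.
pose c : Pi := foldr *%g 1 [seq vertex_incl (tagged x) | x <- s].
have cC (k : Gam d) : commute (vertex_incl k) c.
  rewrite /c {gE c}; elim: s sd => [|[u l] s IHs] sd /=; first exact: commute1.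
  apply: commuteM; last by apply: IHs => x xs; apply: sd; rewrite inE xs orbT.
  by apply: vertex_incl_commute; rewrite eq_sym; apply: (sd _ (mem_head _ _)).
exists (h ^ vertex_proj g).
rewrite [in LHS]gE [in X in _ = X * _]gE -/c -[RHS]mulgA -cC !mulgA.
by rewrite -!vertex_inclM conjgE !mulgA mulgV mul1g.
Qed.

End CliqueProduct.

(** * Transfer of splittings along homomorphisms *)

Section Splitting.
Variable R : realType.

Section Pullback.
Variables (G H : groupType) (X : Type) (a : left_action G X) (phi : H -> G).
Hypothesis phiM : {morph phi : x y / x * y}.

Fact pullback_act1 x : a (phi 1) x = x.
Proof. by rewrite (morphM1 phiM) lact1. Qed.

Fact pullback_actM g h x : a (phi (g * h)) x = a (phi g) (a (phi h) x).
Proof. by rewrite phiM lactM. Qed.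

Definition pullback_action : left_action H X :=
  @LeftAction H X (fun h => a (phi h)) pullback_act1 pullback_actM.

End Pullback.

(** The restricted action satisfies every condition at once except the absence
    of a fixed vertex. A vertex fixed by the normal subgroup [phi(H)] but moved
    by [G] would force [phi(H)] to fix an edge, and [H] to be amenable. *)
Lemma splits_restrict (H G : groupType) (phi : H -> G) :
  {morph phi : x y / x * y} -> injective phi ->
  (forall g h, exists k, phi h * g = g * phi k) -> ~ amenable R H ->
  splits_over_amenable R G -> splits_over_amenable R H.
Proof.
move=> phiM phiI phiN amenH [T [adj [a [[treeT aadj] nofix noinv amenE]]]].
(* A group that embeds in an edge stabilizer of [G] is amenable. *)
have sub (K : groupType) (psi : K -> G) x y : {morph psi : g h / g * h} ->
    injective psi -> adj x y -> (forall k, edge_stab a x y (psi k)) ->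
    amenable R K.
  move=> psiM psiI xy psiS.
  have mG := has_mean_commuting (amenE x y xy) (@valM _ _ _)
    (has_mean_dirac R G) (fun h g => False_rect _).
  apply: (amenable_of_injective psiM psiI _ mG) => k; right.
  by exists (exist _ (psi k) (psiS k)).
exists T, adj, (pullback_action a phiM); split=> /=.
- by split=> // g x y; exact: aadj.
- case=> x xfix; apply: nofix; exists x => g; apply/eqP/negPn/negP.
  rewrite eq_sym => xg.
  have gfix h : a (phi h) (a g x) = a g x.
    by have [k hk] := phiN g h; rewrite -lactM hk lactM xfix.
  have [z xz zfix] := tree_fixed_edge (a := pullback_action a phiM) treeT
    (fun h => aadj (phi h)) xfix gfix xg.
  apply: amenH; apply: (sub _ phi x z) => // h.
  have zh : a (phi h) z = z := zfix h.
  by rewrite /edge_stab xfix zh !eqxx.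
- by case=> h [x [y xy]]; apply: noinv; exists (phi h), x, y.
- move=> x y xy; pose S := edge_stabilizer (pullback_action a phiM) x y.
  apply: (sub S (phi \o val) x y) => //.
  + by move=> g h; rewrite /= -phiM.
  + by move=> g h /phiI/val_inj.
  + by case.
Qed.

(** The condition on preimages says that [p] has an amenable kernel in the form
    used here: preimages of amenable subgroups are amenable. *)
Lemma splits_pullback (G Q : groupType) (p : G -> Q) :
  {morph p : x y / x * y} -> (forall q, exists g, p g = q) ->
  (forall (H : groupType) (phi : H -> Q), {morph phi : x y / x * y} ->
     amenable R H -> has_mean R (fun g => exists h, p g = phi h)) ->
  splits_over_amenable R Q -> splits_over_amenable R G.
Proof.
move=> pM pS meanP [T [adj [a [[treeT aadj] nofix noinv amenE]]]].
exists T, adj, (pullback_action a pM); split=> /=.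
- by split=> // g x y; exact: aadj.
- case=> x xfix; apply: nofix; exists x => q.
  by have [g <-] := pS q; exact: xfix.
- by case=> g [x [y xy]]; apply: noinv; exists (p g), x, y.
- move=> x y xy; have mG := meanP _ _ (@valM _ _ _) (amenE x y xy).
  apply: (amenable_of_injective (@valM _ _ _) val_inj _ mG) => -[g gS].
  by exists (exist _ (p g) gS).
Qed.

End Splitting.

Theorem proposition1 (R : realType) (V : finType) (E : rel V)
    (Gam : V -> groupType) (d : V)
    (E_sym : symmetric E) (E_irrefl : irreflexive E)
    (E_clique : forall u v : V, u != v -> E u v)
    (Gam_fg : forall u : V, finitely_generated (Gam u))
    (Gam_nonamenable : forall u : V, ~ amenable R (Gam u) <-> u = d) :
  splits_over_amenable R (graph_product E Gam) <->
  splits_over_amenable R (Gam d).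
Proof.
have amen u : u != d -> amenable R (Gam u).
  by move=> ud; apply: contrapT => /Gam_nonamenable/eqP; rewrite (negPf ud).
split.
- apply: (splits_restrict (@vertex_inclM _ E _ d)).
  + exact/can_inj/vertex_inclK.
  + exact: (vertex_incl_normal E_irrefl E_clique).
  + exact/Gam_nonamenable.
- apply: (splits_pullback (vertex_projM E_irrefl d)).
  + by move=> q; exists (vertex_incl E q); exact: vertex_inclK.
  + by move=> H phi phiM amenH; exact: vertex_proj_preimage_has_mean.
Qed.
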